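(* Let $M^n$ be a Hantzsche-Wendt manifold of dimension $n$. Then its tangent bundle is line element parallelizable, i.e. it is isomorphic to a direct (Whitney) sum of real line bundles over $M^n$.
   Context: A flat manifold of dimension $n$ is a compact connected Riemannian manifold without boundary, of dimension $n$, with sectional curvature equal to zero. It is of the form $\mathbb{R}^n/\Gamma$ with $\Gamma=\pi_1(M^n)$ a torsion-free discrete cocompact subgroup of $\operatorname{Isom}(\mathbb{R}^n)=\operatorname{O}(n)\ltimes\mathbb{R}^n$; its holonomy group is isomorphic to the (finite) image of $\Gamma$ under the projection $(A,a)\mapsto A$. A Hantzsche-Wendt manifold (HW-manifold) of dimension $n$ is an oriented flat manifold of dimension $n$ with holonomy group $(\mathbb{Z}_2)^{n-1}$. *)

(* Defs.v *)
(* MathComp / MathComp-Analysis. *)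
From Stdlib Require Import Eqdep_dec.
From HB Require Import structures.
From mathcomp Require Import all_boot all_order all_algebra.
From mathcomp Require Import all_classical all_reals all_analysis.
Import numFieldNormedType.Exports.

Set Implicit Arguments.
Unset Strict Implicit.
Unset Printing Implicit Defensive.

Import Order.TTheory GRing.Theory Num.Theory.
Local Open Scope classical_set_scope.
Local Open Scope ring_scope.

(* Partial homeomorphisms: [phomeo_fun] restricts to a homeomorphism from the
   open set [source] onto the open set [target], with inverse [phomeo_inv];
   the values outside [source] and [target] are irrelevant. *)
Record phomeo (X Y : topologicalType) := PHomeo {
  source : set X;
  target : set Y;
  phomeo_fun : X -> Y;
  phomeo_inv : Y -> X;
  source_open : open source;
  target_open : open target;
  phomeo_fun_target : forall x, source x -> target (phomeo_fun x);
  phomeo_inv_source : forall y, target y -> source (phomeo_inv y);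
  phomeo_funK : forall x, source x -> phomeo_inv (phomeo_fun x) = x;
  phomeo_invK : forall y, target y -> phomeo_fun (phomeo_inv y) = y;
  phomeo_fun_continuous : forall x, source x -> {for x, continuous phomeo_fun};
  phomeo_inv_continuous : forall y, target y -> {for y, continuous phomeo_inv}
}.

Section SmoothManifolds.
Variable R : realType.

(* For an open set U of a finite-dimensional space V, [Ck_on k U f] says that
   f is of class C^k on U: iterated directional derivatives up to order k - 1
   are differentiable on U and those of order k are continuous on U. *)
Fixpoint Ck_on (V W : normedModType R) (k : nat) (U : set V) (f : V -> W) :=
  if k is k'.+1 then
    (forall x, U x -> differentiable f x) /\
    (forall v, Ck_on k' U (fun x => 'D_v f x))
  else forall x, U x -> {for x, continuous f}.

Definition smooth_on (V W : normedModType R) (U : set V) (f : V -> W) :=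
  forall k, Ck_on k U f.

Variables (n : nat) (M : topologicalType).

Definition chart := phomeo M 'cV[R]_n.

Definition transition (c d : chart) : 'cV[R]_n -> 'cV[R]_n :=
  phomeo_fun d \o phomeo_inv c.

Definition transition_domain (c d : chart) : set 'cV[R]_n :=
  [set x | target c x /\ source d (phomeo_inv c x)].

Definition compatible (c d : chart) :=
  smooth_on (transition_domain c d) (transition c d) /\
  smooth_on (transition_domain d c) (transition d c).

Record smooth_manifold := SmoothManifold {
  chart_index : Type;
  chart_at : chart_index -> chart;
  chart_cover : forall p, exists i, source (chart_at i) p;
  chart_compatible : forall i j, compatible (chart_at i) (chart_at j);
  manifold_hausdorff : hausdorff_space M;
  manifold_second_countable : @second_countable M
}.

(* Membership in the maximal atlas. *)
Definition smooth_chart (A : smooth_manifold) (c : chart) :=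
  forall i, compatible (@chart_at A i) c.

Definition jacobian_matrix (f : 'cV[R]_n -> 'cV[R]_n) (x : 'cV[R]_n) :
    'M[R]_n :=
  \matrix_(i, j) ('d f x : 'cV[R]_n -> 'cV[R]_n) (delta_mx j 0) i 0.

Definition orientable (A : smooth_manifold) :=
  exists O : set chart,
    [/\ forall c, O c -> smooth_chart A c,
        forall p, exists2 c, O c & source c p
      & forall c d x, O c -> O d -> transition_domain c d x ->
          0 < \det (jacobian_matrix (transition c d) x)].

End SmoothManifolds.
Arguments chart_at {R n M} s _.

(* A family of real vector spaces over B: a topological space with a map to B,
   whose fibre over b is identified by [fibre_point b] with the vector space
   [fibre b]. It is a vector bundle when it is moreover locally trivial. *)
Record vector_family (R : realType) (B : topologicalType) := VectorFamily {
  total_space : topologicalType;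
  bundle_proj : total_space -> B;
  fibre : B -> lmodType R;
  fibre_point : forall b, fibre b -> total_space;
  fibre_point_inj : forall b, injective (@fibre_point b);
  fibre_point_range : forall b, range (@fibre_point b) = bundle_proj @^-1` [set b]
}.
Arguments fibre_point {R B} v {b} _.

Section VectorBundles.
Variables (R : realType) (B : topologicalType).
Implicit Types E F : vector_family R B.

(* A trivialization over U is a homeomorphism p^-1 U ~ U * R^k over U which
   is linear on the fibres. *)
Definition trivialization E (k : nat) (U : set B)
    (h : phomeo (total_space E) (B * 'cV[R]_k)%type) :=
  [/\ source h = @bundle_proj _ _ E @^-1` U,
      target h = U `*` setT,
      forall e, source h e -> (phomeo_fun h e).1 = bundle_proj e
    & forall b, U b -> linear (fun v : fibre E b => (phomeo_fun h (fibre_point E v)).2)].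

Definition vector_bundle (k : nat) E :=
  continuous (@bundle_proj _ _ E) /\
  forall b, exists U : set B, [/\ open U, U b &
    exists h : phomeo (total_space E) (B * 'cV[R]_k)%type, trivialization U h].

Definition line_bundle E := vector_bundle 1 E.

Definition bundle_isomorphic E F :=
  exists (f : total_space E -> total_space F) (g : total_space F -> total_space E)
         (fb : forall b, {linear fibre E b -> fibre F b}),
    [/\ continuous f, continuous g, cancel f g, cancel g f
      & forall b (v : fibre E b), f (fibre_point E v) = fibre_point F (fb b v)].

End VectorBundles.

Lemma existT_inj (B : eqType) (P : B -> Type) (b : B) :
  injective (existT P b).
Proof.
move=> u v /(@Eqdep_dec.inj_pair2_eq_dec B _ P b u v); apply.
by move=> x y; case: (eqVneq x y) => [->|/eqP]; [left|right].
Qed.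

Lemma existT_range (B : eqType) (P : B -> Type) (b : B) :
  range (existT P b) = (@projT1 B P) @^-1` [set b].
Proof.
apply/seteqP; split=> [_ [v _ <-]//|[c v] /= cb].
by case: _ / cb v => v; exists v.
Qed.

(* Dependent products of vector spaces. *)
Definition dprod (I : Type) (V : I -> Type) := forall i, V i.

Section DependentProduct.
Variables (R : realType) (I : Type) (V : I -> lmodType R).
Local Notation W := (dprod (fun i => V i : Type)).

Let add (f g : W) : W := fun i => f i + g i.
Let opp (f : W) : W := fun i => - f i.
Let scale (a : R) (f : W) : W := fun i => a *: f i.

Let addA : associative add.
Proof. by move=> f g h; apply: functional_extensionality_dep => i; exact: addrA. Qed.
Let addC : commutative add.
Proof. by move=> f g; apply: functional_extensionality_dep => i; exact: addrC. Qed.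
Let add0 : left_id (fun i => 0 : V i) add.
Proof. by move=> f; apply: functional_extensionality_dep => i; exact: add0r. Qed.
Let addN : left_inverse (fun i => 0 : V i) opp add.
Proof. by move=> f; apply: functional_extensionality_dep => i; exact: addNr. Qed.

HB.instance Definition _ := gen_eqMixin W.
HB.instance Definition _ := gen_choiceMixin W.
HB.instance Definition _ := GRing.isZmodule.Build W addA addC add0 addN.

Let scaleA a b (f : W) : scale a (scale b f) = scale (a * b) f.
Proof. by apply: functional_extensionality_dep => i; exact: scalerA. Qed.
Let scale1 : left_id 1 scale.
Proof. by move=> f; apply: functional_extensionality_dep => i; exact: scale1r. Qed.
Let scaleDr : right_distributive scale +%R.
Proof. by move=> a f g; apply: functional_extensionality_dep => i; exact: scalerDr. Qed.
Let scaleDl (f : W) : {morph scale^~ f : a b / a + b}.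
Proof. by move=> a b; apply: functional_extensionality_dep => i; exact: scalerDl. Qed.

HB.instance Definition _ :=
  GRing.Zmodule_isLmodule.Build R W scaleA scale1 scaleDr scaleDl.

End DependentProduct.

Section WhitneySum.
Variables (R : realType) (B : topologicalType) (k : nat).
Variable L : 'I_k -> vector_family R B.

Definition whitney_fibre (b : B) : lmodType R :=
  dprod (fun i => fibre (L i) b : Type).

Definition whitney_point := {b : B & whitney_fibre b}.
HB.instance Definition _ := gen_eqMixin whitney_point.
HB.instance Definition _ := gen_choiceMixin whitney_point.

(* The total space is topologized as the fibre product of the total spaces. *)
Definition whitney_incl (e : whitney_point) :
    (B * prod_topology (fun i => total_space (L i)))%type :=
  (projT1 e, fun i => fibre_point (L i) (projT2 e i)).

Definition whitney_sum : vector_family R B :=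
  @VectorFamily R B (initial_topology whitney_incl) (@projT1 _ _)
    whitney_fibre (fun b => existT _ b)
    (@existT_inj B _) (@existT_range B _).

End WhitneySum.

Section TangentBundle.
Variables (R : realType) (n : nat) (M : topologicalType).
Variable A : smooth_manifold R n M.
Local Notation I := (chart_index A).
Local Notation ch := (chart_at A).

(* A tangent vector at p is a family of vectors of R^n, one for each chart
   around p, related by the differentials of the transition maps. Families are
   extended by 0 to the charts not containing p. *)
Definition tangent_pred (p : M) : {pred I -> 'cV[R]_n} := [pred v | `[<
  (forall i, ~ source (ch i) p -> v i = 0) /\
  (forall i j, source (ch i) p -> source (ch j) p ->
     v j = 'd (transition (ch i) (ch j)) (phomeo_fun (ch i) p) (v i)) >]].

Fact tangent_submod_closed p : submod_closed (tangent_pred p).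
Proof.
split; first by apply/asboolP; split=> // i j _ _; rewrite linear0.
move=> a u v /asboolP[u0 uT] /asboolP[v0 vT]; apply/asboolP; split=> [i ip|].
  by rewrite /= -[LHS]/(a *: u i + v i) u0// v0// scaler0 addr0.
move=> i j ip jp; rewrite -[LHS]/(a *: u j + v j).
by rewrite (uT i j)// (vT i j)// -linearP.
Qed.

HB.instance Definition _ p :=
  GRing.isSubmodClosed.Build _ _ (tangent_pred p) (tangent_submod_closed p).

Record tangent_space (p : M) := TangentVector {
  tangent_coord :> I -> 'cV[R]_n;
  tangent_coordP : tangent_coord \in tangent_pred p
}.

HB.instance Definition _ p := [isSub for @tangent_coord p].
HB.instance Definition _ p := [Choice of tangent_space p by <:].
HB.instance Definition _ p := [SubChoice_isSubLmodule of tangent_space p by <:].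

Definition tangent_point := {p : M & tangent_space p}.
HB.instance Definition _ := gen_eqMixin tangent_point.
HB.instance Definition _ := gen_choiceMixin tangent_point.

(* The chart of the tangent bundle induced by the i-th chart. *)
Definition tangent_chart (i : I) (e : tangent_point) :
    ('cV[R]_n * 'cV[R]_n)%type :=
  (phomeo_fun (ch i) (projT1 e), projT2 e i).

Definition tangent_subbase : set (set tangent_point) :=
  [set O | exists i (W : set ('cV[R]_n * 'cV[R]_n)%type), open W /\
     O = [set e | source (ch i) (projT1 e) /\ W (tangent_chart i e)]].

HB.instance Definition _ :=
  isSubBaseTopological.Build tangent_point tangent_subbase id.

Definition tangent_bundle : vector_family R M :=
  @VectorFamily R M tangent_point (@projT1 _ _)
    tangent_space (fun p => existT _ p)
    (@existT_inj M _) (@existT_range M _).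

Definition line_element_parallelizable :=
  exists (k : nat) (L : 'I_k -> vector_family R M),
    (forall i, line_bundle (L i)) /\
    bundle_isomorphic tangent_bundle (whitney_sum L).

End TangentBundle.

Section FlatManifolds.
Variables (R : realType) (n : nat).

(* The pair (A, a) stands for the map x |-> A x + a. *)
Definition affine := ('M[R]_n * 'cV[R]_n)%type.
Definition affine_act (g : affine) (x : 'cV[R]_n) : 'cV[R]_n := g.1 *m x + g.2.
Definition affine_one : affine := (1%:M, 0).
Definition affine_mul (g h : affine) : affine :=
  (g.1 *m h.1, g.1 *m h.2 + g.2).

Definition euclidean_isometry : set affine := [set g | g.1^T *m g.1 = 1%:M].

Definition isometry_subgroup (G : set affine) :=
  [/\ G `<=` euclidean_isometry,
      G affine_one,
      forall g h, G g -> G h -> G (affine_mul g h)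
    & forall g, G g -> exists2 h, G h & affine_mul h g = affine_one].

Definition discrete_subset (G : set affine) := isolated G = G.

Definition torsion_free (G : set affine) :=
  forall g k, G g -> (0 < k)%N ->
    iter k (affine_mul g) affine_one = affine_one -> g = affine_one.

Definition holonomy (G : set affine) : set 'M[R]_n := [set g.1 | g in G].

(* [q] exhibits M as the smooth quotient manifold R^n / G: it is onto, its
   fibres are the G-orbits, and its local inverses are smooth charts of M. *)
Definition orbit_projection (M : topologicalType) (A : smooth_manifold R n M)
    (G : set affine) (q : 'cV[R]_n -> M) :=
  [/\ forall p, exists x, q x = p,
      forall x y, q x = q y <-> exists2 g, G g & affine_act g x = y
    & forall x, exists c : chart R n M,
        [/\ smooth_chart A c, target c x
          & forall y, target c y -> phomeo_inv c y = q y]].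

(* M = R^n / G is a flat manifold with fundamental group G; cocompactness of G
   is the compactness of M. *)
Definition flat_manifold (M : topologicalType) (A : smooth_manifold R n M)
    (G : set affine) :=
  [/\ isometry_subgroup G, discrete_subset G, torsion_free G,
      compact [set: M] & exists q, orbit_projection A G q].

Definition elementary_2group (m : nat) (H : set 'M[R]_n) :=
  exists f : 'rV['Z_2]_m -> 'M[R]_n,
    [/\ injective f, forall u v, f (u + v) = f u *m f v & range f = H].

Definition hantzsche_wendt (M : topologicalType) (A : smooth_manifold R n M) :=
  [/\ (0 < n)%N, orientable A &
      exists2 G, flat_manifold A G & elementary_2group n.-1 (holonomy G)].

End FlatManifolds.

(* Main.v *)
(* Every deck transformation x |-> A x + a has linear part in the holonomy
   group, which consists of commuting involutions; these are diagonal in a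
   common basis (P e_k).  Pushing this constant frame of R^n down along
   q : R^n -> M gives at each point of M a frame that depends on the chosen lift
   only up to a nonzero factor on each vector, since a deck transformation
   multiplies P e_k by an eigenvalue.  Hence the lines spanned by the P e_k
   descend to line subbundles of TM whose sum is TM.  The frame over M is chosen
   pointwise, without continuity: each line bundle takes its topology from
   TM. *)
Require Import Defs.
From HB Require Import structures.
From mathcomp Require Import finmap.
From mathcomp Require Import all_boot all_order all_algebra.
From mathcomp Require Import all_classical all_reals all_analysis.
Import numFieldNormedType.Exports.

Set Implicit Arguments.
Unset Strict Implicit.
Unset Printing Implicit Defensive.

Import Order.TTheory GRing.Theory Num.Theory.
Local Open Scope classical_set_scope.
Local Open Scope ring_scope.

(** * Continuity at a point, tested locally or through initial topologies *)

Lemma near_eq_continuous_at (X Y : topologicalType) (f g : X -> Y) x :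
  (\forall y \near x, f y = g y) -> {for x, continuous g} ->
  {for x, continuous f}.
Proof.
move=> fg gx; rewrite /prop_for /continuous_at (nbhs_singleton fg).
by apply: cvg_trans gx; apply: near_eq_cvg; near do apply/esym.
Unshelve. all: by end_near. Qed.

Lemma continuous_at_pair (X Y Z : topologicalType) (f : X -> Y) (g : X -> Z) x :
  {for x, continuous f} -> {for x, continuous g} ->
  {for x, continuous (fun y => (f y, g y))}.
Proof. by move=> fx gx; apply: cvg_pair. Qed.

Lemma continuous_at_initial (X : topologicalType) (Y : choiceType)
    (Z : topologicalType) (w : Y -> Z) (f : X -> initial_topology w) x :
  {for x, continuous (w \o f)} -> {for x, continuous f}.
Proof.
move=> wf A; rewrite [nbhs (f x)]nbhsE => -[_ [[V oV <-] /= Vx] VA].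
have H : nbhs x ((w \o f) @^-1` V) by apply: wf; exact: open_nbhs_nbhs.
by change (nbhs x (f @^-1` A)); apply: filterS H => y; exact: VA.
Qed.

Lemma continuous_at_prod_topology (X : topologicalType) (I : Type)
    (K : I -> topologicalType) (f : X -> prod_topology K) x :
  (forall i, {for x, continuous (fun y => f y i)}) -> {for x, continuous f}.
Proof.
move=> fi; rewrite /prop_for /continuous_at.
apply/cvg_sup => i A.
have /= -> := @nbhsE (initial_topology (fun g : (forall i, K i) => g i)) (f x).
case=> _ [[V oV <-] /= Vx] VA.
have H : nbhs x ((f^~ i) @^-1` V) by apply: fi; exact: open_nbhs_nbhs.
by change (nbhs x (f @^-1` A)); apply: filterS H => y; exact: VA.
Qed.

Lemma continuous_at_sum (X : topologicalType) (R : realType)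
    (V : normedModType R) (I : Type) (r : seq I) (f : I -> X -> V) x :
  (forall i, {for x, continuous (f i)}) ->
  {for x, continuous (fun y => \sum_(i <- r) f i y)}.
Proof.
move=> fx; elim: r => [|i r IH].
  rewrite (_ : (fun y => _) = fun=> 0); first exact: cvg_cst.
  by apply/funext => y; rewrite big_nil.
rewrite (_ : (fun y => _) = f i \+ (fun y => \sum_(j <- r) f j y)).
  by apply: continuousD => //; exact: fx.
by apply/funext => y; rewrite big_cons.
Qed.

(** * Splitting a bundle along a pointwise, possibly discontinuous frame *)

Section Frames.
Variables (R : realType) (B : topologicalType) (E : vector_family R B).

Lemma bundle_proj_fibre_point b (v : fibre E b) :
  bundle_proj (fibre_point E v) = b.
Proof.
have : range (@fibre_point _ _ E b) (fibre_point E v) by exists v.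
by rewrite fibre_point_range.
Qed.

Lemma fibre_pointP (x : total_space E) :
  exists v : fibre E (bundle_proj x), fibre_point E v = x.
Proof.
have : ((@bundle_proj _ _ E) @^-1` [set bundle_proj x]) x by [].
by rewrite -fibre_point_range => -[v _ vx]; exists v.
Qed.

(** The choice is harmless: [fibre_point] is injective, so only one vector qualifies. *)
Definition fibre_vec x : fibre E (bundle_proj x) :=
  projT1 (cid (fibre_pointP x)).

Lemma fibre_vecK x : fibre_point E (fibre_vec x) = x.
Proof. by rewrite /fibre_vec; case: cid. Qed.

Variables (n : nat) (e : forall b, 'I_n -> fibre E b).

Definition line_incl k (x : B * R^o) : total_space E :=
  fibre_point E (x.2 *: e x.1 k).

Fact line_point_inj (b : B) : injective (fun t : R^o => (b, t)).
Proof. by move=> s t []. Qed.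

Fact line_point_range (b : B) :
  range (fun t : R^o => (b, t)) = (@fst B R^o) @^-1` [set b].
Proof. by apply/seteqP; split=> [_ [t _ <-]//|[c t] /= <-]; exists t. Qed.

(** The pair [(b, t)] stands for the vector [t *: e b k], and the topology is pulled back from [E]
    accordingly. The product topology of B and R would always give a trivial bundle, unrelated to
    [E] when [e] jumps. *)
Definition line_subbundle k : vector_family R B :=
  @VectorFamily R B (initial_topology (line_incl k)) (@fst B R^o) (fun=> R^o)
    (fun b t => (b, t)) line_point_inj line_point_range.

Lemma line_incl_continuous k :
  continuous (line_incl k : total_space (line_subbundle k) -> total_space E).
Proof. exact: initial_continuous. Qed.

(** The substitute for continuity of the frame: its vectors may jump, but in the trivialization they
    stay on the coordinate axes. No continuity is asked of the factors [a]. *)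
Definition adapted (U : set B) (h : phomeo (total_space E) (B * 'cV[R]_n)%type)
    (a : B -> 'I_n -> R) :=
  [/\ open U, trivialization U h & forall b k, U b -> a b k != 0 /\
      (phomeo_fun h (fibre_point E (e b k))).2 = a b k *: delta_mx k 0].

Hypothesis bundle_proj_cont : continuous (@bundle_proj _ _ E).

Section Adapted.
Variables (U : set B) (h : phomeo (total_space E) (B * 'cV[R]_n)%type).
Variable a : B -> 'I_n -> R.
Hypothesis ha : adapted U h a.

Definition triv_vec b (v : fibre E b) := (phomeo_fun h (fibre_point E v)).2.

Let sourceE b (v : fibre E b) : U b -> source h (fibre_point E v).
Proof.
by case: ha => _ [-> _ _ _] _ Ub; rewrite /preimage /= bundle_proj_fibre_point.
Qed.

Lemma triv_vec_linear b : U b -> linear (@triv_vec b).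
Proof. by case: ha => _ [_ _ _ H] _ Ub; exact: H. Qed.

Lemma phomeo_fun_fibre_point b (v : fibre E b) : U b ->
  phomeo_fun h (fibre_point E v) = (b, triv_vec v).
Proof.
move=> Ub; have [_ [_ _ H _] _] := ha.
by rewrite [LHS]surjective_pairing H ?bundle_proj_fibre_point//; exact: sourceE.
Qed.

Lemma triv_vec_inj b (v w : fibre E b) :
  U b -> triv_vec v = triv_vec w -> v = w.
Proof.
move=> Ub vw; apply: (@fibre_point_inj _ _ E b).
by rewrite -[LHS](phomeo_funK (sourceE _ Ub)) -[RHS](phomeo_funK (sourceE _ Ub))
  !phomeo_fun_fibre_point// vw.
Qed.

Lemma triv_vecZ b t (v : fibre E b) :
  U b -> triv_vec (t *: v) = t *: triv_vec v.
Proof.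
move=> Ub; pose f := GRing.isLinear.Build _ _ _ _ _ (triv_vec_linear Ub).
pose F : {linear fibre E b -> 'cV[R]_n} := HB.pack (@triv_vec b) f.
exact: (linearZ_LR F).
Qed.

Lemma triv_vec_sum b (f : 'I_n -> fibre E b) : U b ->
  triv_vec (\sum_k f k) = \sum_k triv_vec (f k).
Proof.
move=> Ub; pose f' := GRing.isLinear.Build _ _ _ _ _ (triv_vec_linear Ub).
pose F : {linear fibre E b -> 'cV[R]_n} := HB.pack (@triv_vec b) f'.
exact: (linear_sum F).
Qed.

Lemma triv_vec_frame b k t : U b ->
  triv_vec (t *: e b k) = (t * a b k) *: delta_mx k 0.
Proof.
move=> Ub; rewrite triv_vecZ//; have [_ _ /(_ b k Ub)[_ H]] := ha.
by rewrite /triv_vec H scalerA.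
Qed.

Lemma frame_decomposition b (v : fibre E b) : U b ->
  v = \sum_k (triv_vec v k 0 / a b k) *: e b k.
Proof.
move=> Ub; apply: triv_vec_inj => //; rewrite triv_vec_sum//.
rewrite [LHS]matrix_sum_delta; apply: eq_bigr => k _.
rewrite big_ord1 triv_vec_frame// divfK//.
by have [_ _ /(_ b k Ub)[]] := ha.
Qed.


Lemma line_subbundle_proj_continuous k :
  continuous (@bundle_proj _ _ (line_subbundle k)).
Proof.
have -> : @bundle_proj _ _ (line_subbundle k) =
    (@bundle_proj _ _ E) \o line_incl k.
  by apply/funext => x /=; rewrite bundle_proj_fibre_point.
move=> x; apply: (@continuous_comp (total_space (line_subbundle k)) _ _
  (line_incl k)); [exact: line_incl_continuous|exact: bundle_proj_cont].
Qed.

Lemma continuous_triv_vec (X : topologicalType) (f : X -> total_space E) x :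
  {for x, continuous f} -> U (bundle_proj (f x)) ->
  {for x, continuous (fun y => (phomeo_fun h (f y)).2)}.
Proof.
move=> fx Ux; have [_ [sE _ _ _] _] := ha.
apply: (@continuous_comp _ _ _ (fun y => phomeo_fun h (f y)) snd); last first.
  by apply: cvg_snd.
apply: continuous_comp => //; apply: phomeo_fun_continuous.
by rewrite sE.
Qed.

Lemma continuous_phomeo_inv (X : topologicalType) (p : X -> B)
    (u : X -> 'cV[R]_n) x :
  {for x, continuous p} -> {for x, continuous u} -> U (p x) ->
  {for x, continuous (fun y => phomeo_inv h (p y, u y))}.
Proof.
move=> cp cu Ux; have [_ [_ tE _ _] _] := ha.
apply: (@continuous_comp _ _ _ (fun y => (p y, u y)) (phomeo_inv h)).
  exact: continuous_at_pair.
by apply: phomeo_inv_continuous; rewrite tE.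
Qed.

Lemma phomeo_inv_triv_vec b (v : fibre E b) : U b ->
  phomeo_inv h (b, triv_vec v) = fibre_point E v.
Proof.
by move=> Ub; rewrite -phomeo_fun_fibre_point// phomeo_funK//; exact: sourceE.
Qed.

(** The coordinate [t] may jump along with the frame; what varies continuously is the product
    [t * a b k], the k-th coordinate under [h] of the vector that [(b, t)] stands for. *)
Lemma line_trivialization k :
  exists g : phomeo (total_space (line_subbundle k)) (B * 'cV[R]_1)%type,
    trivialization U g.
Proof.
have [oU _ aE] := ha.
pose L := line_subbundle k.
pose S : set (total_space L) := @bundle_proj _ _ L @^-1` U.
pose T : set (B * 'cV[R]_1) := U `*` setT.
pose f (x : total_space L) : (B * 'cV[R]_1)%type :=
  (x.1, (x.2 * a x.1 k) *: const_mx 1).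
pose g (y : (B * 'cV[R]_1)%type) : total_space L := (y.1, y.2 0 0 / a y.1 k).
have a0 b : U b -> a b k != 0 by move=> /(aE b k)[].
have oS : open S.
  by apply: open_comp => // x _; exact: line_subbundle_proj_continuous.
have TE : T = fst @^-1` U.
  by apply/seteqP; split=> [[b u] []//|[b u] /= Ub]; split.
have oT : open T by rewrite TE; apply: open_comp => // x _; exact: cvg_fst.
have fT x : S x -> T (f x) by move=> Sx; split.
have gS y : T y -> S (g y) by case.
have fK x : S x -> g (f x) = x.
  by case: x => b t Sx; rewrite /g /f /= !mxE mulr1 mulfK// a0.
have gK y : T y -> f (g y) = y.
  case: y => b u [Ub _]; rewrite /g /f /= divfK ?a0//; congr (_, _).
  by apply/colP => i; rewrite !mxE mulr1 ord1.
have fc x : S x -> {for x, continuous f}.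
  move=> Sx; apply: continuous_at_pair.
    exact: line_subbundle_proj_continuous.
  (* Over [U] the factor [a] is absorbed: the formula is rewritten through [h] and [line_incl k],
     which are continuous. *)
  apply: (@near_eq_continuous_at _ _ _ (fun x : total_space L =>
     (phomeo_fun h (line_incl k x)).2 k 0 *: (const_mx 1 : 'cV[R]_1))).
    near=> y; congr (_ *: _).
    have Uy : U y.1 by near: y; apply: open_nbhs_nbhs.
    by rewrite -/(triv_vec _) triv_vec_frame// !mxE !eqxx mulr1.
  apply: continuousZr_tmp; apply: (@continuous_comp _ _ _
     (fun y : total_space L => (phomeo_fun h (line_incl k y)).2)
     (fun u : 'cV[R]_n => u k 0)); last exact: coord_continuous.
  apply: continuous_triv_vec; first exact: line_incl_continuous.
  by rewrite bundle_proj_fibre_point.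
have gc y : T y -> {for y, continuous g}.
  move=> Ty; apply: continuous_at_initial.
  apply: (@near_eq_continuous_at _ _ _ (fun y : (B * 'cV[R]_1)%type =>
     phomeo_inv h (y.1, y.2 0 0 *: delta_mx k 0))).
    near=> z; have Uz : U z.1.
      by have [] : T z by near: z; apply: open_nbhs_nbhs.
    rewrite /= /line_incl /= -phomeo_inv_triv_vec// triv_vec_frame// divfK//.
    exact: a0.
  apply: continuous_phomeo_inv; [exact: cvg_fst| |by case: Ty].
  apply: continuousZr_tmp; apply: (@continuous_comp _ _ _ snd
     (fun u : 'cV[R]_1 => u 0 0)); [exact: cvg_snd|exact: coord_continuous].
exists (PHomeo oS oT fT gS fK gK fc gc); split=> // b Ub t u v /=.
by rewrite mulrDl -mulrA scalerDl scalerA.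
Unshelve. all: by end_near. Qed.

End Adapted.

Hypothesis cover : forall b, exists U h a, adapted U h a /\ U b.

Lemma line_bundle_line_subbundle k : line_bundle (line_subbundle k).
Proof.
split=> [|b]; first exact: line_subbundle_proj_continuous.
have [U [h [a [ha Ub]]]] := cover b.
by exists U; split=> //; [case: ha|exact: line_trivialization ha k].
Qed.

Lemma frame_span b (v : fibre E b) :
  exists c : 'I_n -> R, v = \sum_k c k *: e b k.
Proof.
have [U [h [a [ha Ub]]]] := cover b.
by eexists; exact: (frame_decomposition ha v Ub).
Qed.

(** Coordinates are chosen without reference to a trivialization, so that they are defined over all
    of [B] at once; [frame_sumK] gives their uniqueness. *)
Definition frame_coord b (v : fibre E b) : 'I_n -> R :=
  projT1 (cid (frame_span v)).

Lemma frame_coordK b (v : fibre E b) : \sum_k frame_coord v k *: e b k = v.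
Proof. by rewrite /frame_coord; case: cid. Qed.

Lemma triv_vec_sum_frame U h a b (c : 'I_n -> R) k : adapted U h a -> U b ->
  triv_vec h (\sum_i c i *: e b i) k 0 = c k * a b k.
Proof.
move=> ha Ub; rewrite (triv_vec_sum ha)// summxE (bigD1 k)//= big1 => [|i ik].
  by rewrite addr0 (triv_vec_frame ha)// !mxE !eqxx mulr1.
by rewrite (triv_vec_frame ha)// !mxE eq_sym (negbTE ik) mulr0.
Qed.

Lemma triv_vec_coord U h a b (v : fibre E b) k : adapted U h a -> U b ->
  triv_vec h v k 0 = frame_coord v k * a b k.
Proof.
by move=> ha Ub; rewrite -(triv_vec_sum_frame _ _ ha)// frame_coordK.
Qed.

(** An adapted trivialization reads the k-th coefficient multiplied by the nonzero [a b k], so the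
    sum determines it. *)
Lemma frame_sumK b (c : 'I_n -> R) : frame_coord (\sum_k c k *: e b k) = c.
Proof.
have [U [h [a [ha Ub]]]] := cover b.
apply/funext => k; have [_ _ /(_ b k Ub)[ak0 _]] := ha.
by apply: (mulIf ak0); rewrite -(triv_vec_coord _ _ ha)//
  (triv_vec_sum_frame _ _ ha).
Qed.

Local Notation W := (whitney_sum line_subbundle).

Lemma frame_coord_linear b :
  linear (fun v : fibre E b => frame_coord v : fibre W b).
Proof.
move=> t v w; rewrite -[in LHS](frame_coordK v) -[in LHS](frame_coordK w).
rewrite scaler_sumr -big_split /=; under eq_bigr do rewrite scalerA -scalerDl.
by rewrite frame_sumK.
Qed.

Definition to_whitney (x : total_space E) : total_space W :=
  existT _ (bundle_proj x) (frame_coord (fibre_vec x)).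

Definition of_whitney (w : total_space W) : total_space E :=
  fibre_point E (\sum_k projT2 w k *: e (projT1 w) k).

Lemma to_whitney_fibre_point b (v : fibre E b) :
  to_whitney (fibre_point E v) = existT _ b (frame_coord v).
Proof.
have := fibre_vecK (fibre_point E v); rewrite /to_whitney.
(* The type of the chosen vector mentions the base point of [fibre_point E v], which is [b] only up
   to a proved equality; generalizing the vector first makes the rewriting well typed. *)
move: (fibre_vec _); rewrite bundle_proj_fibre_point => v'.
by move=> /fibre_point_inj ->.
Qed.

Lemma to_whitneyK : cancel to_whitney of_whitney.
Proof. by move=> x; rewrite /of_whitney frame_coordK fibre_vecK. Qed.

Lemma of_whitneyK : cancel of_whitney to_whitney.
Proof.
by case=> b c; rewrite /of_whitney to_whitney_fibre_point frame_sumK.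
Qed.

(** Both the sum and its summands carry initial topologies, so it is enough to look at the base
    point and, for each k, at the component along [e b k] as a point of [E]. Under [h] that
    component is the projection onto the k-th axis, whatever the factors [a] are. *)
Lemma to_whitney_continuous : continuous to_whitney.
Proof.
apply: continuous_comp_initial => x.
apply: (@continuous_at_pair _ B
  (prod_topology (fun k => total_space (line_subbundle k)))
  (@bundle_proj _ _ E)
  (fun y k => (bundle_proj y, frame_coord (fibre_vec y) k))).
  exact: bundle_proj_cont.
apply: continuous_at_prod_topology => k.
apply: (@continuous_at_initial _ _ _ (line_incl k)).
have [U [h [a [ha Ux]]]] := cover (bundle_proj x); have [oU _ _] := ha.
apply: (@near_eq_continuous_at _ _ _ (fun y =>
  phomeo_inv h (bundle_proj y, (phomeo_fun h y).2 k 0 *: delta_mx k 0))).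
  near=> y; have Uy : U (bundle_proj y).
    near: y; exact: (@bundle_proj_cont x U (open_nbhs_nbhs (conj oU Ux))).
  rewrite /= /line_incl /= -(phomeo_inv_triv_vec ha)// (triv_vec_frame ha)//.
  by rewrite -(triv_vec_coord _ _ ha)// /triv_vec fibre_vecK.
apply: (continuous_phomeo_inv ha); [exact: bundle_proj_cont| |exact: Ux].
apply: continuousZr_tmp; apply: (@continuous_comp _ _ _
   (fun y => (phomeo_fun h y).2) (fun u : 'cV[R]_n => u k 0)).
  exact: (continuous_triv_vec ha).
exact: coord_continuous.
Unshelve. all: by end_near. Qed.

(** Addition in the fibres of [E] is continuous because [h], linear on fibres, turns it into a
    finite sum of continuous vector-valued maps. *)
Lemma of_whitney_continuous : continuous of_whitney.
Proof.
move=> w; have [U [h [a [ha Uw]]]] := cover (projT1 w); have [oU _ _] := ha.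
have cincl : continuous (@whitney_incl _ _ _ line_subbundle
    : total_space W -> _) by exact: initial_continuous.
have cproj : continuous (@projT1 _ _ : total_space W -> B).
  move=> w'; apply: (@continuous_comp _ _ _
    (@whitney_incl _ _ _ line_subbundle : total_space W -> _) fst).
    exact: cincl.
  exact: cvg_fst.
have ccomp k : continuous (fun w' : total_space W =>
    line_incl k (projT1 w', projT2 w' k)).
  move=> w'; apply: (@continuous_comp _ (total_space (line_subbundle k)) _
    (fun w' : total_space W => (projT1 w', projT2 w' k)) (line_incl k)).
    apply: (@continuous_comp (total_space W)
      (prod_topology (fun k => total_space (line_subbundle k)))
      (total_space (line_subbundle k))
      (fun w' => (whitney_incl w').2) (proj k)); last exact: proj_continuous.
    apply: (@continuous_comp _ _ _
      (@whitney_incl _ _ _ line_subbundle : total_space W -> _) snd).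
      exact: cincl.
    exact: cvg_snd.
  exact: line_incl_continuous.
apply: (@near_eq_continuous_at _ _ _ (fun w' : total_space W =>
  phomeo_inv h (projT1 w',
    \sum_k (phomeo_fun h (line_incl k (projT1 w', projT2 w' k))).2))).
  near=> w'; have Uw' : U (projT1 w').
    near: w'; exact: (@cproj w U (open_nbhs_nbhs (conj oU Uw))).
  rewrite /of_whitney -(phomeo_inv_triv_vec ha)// (triv_vec_sum ha)//.
apply: (continuous_phomeo_inv ha); [exact: cproj| |exact: Uw].
apply: continuous_at_sum => k; apply: (continuous_triv_vec ha).
  exact: ccomp.
by rewrite bundle_proj_fibre_point.
Unshelve. all: by end_near. Qed.

Lemma line_splitting :
  exists L : 'I_n -> vector_family R B,
    (forall k, line_bundle (L k)) /\ bundle_isomorphic E (whitney_sum L).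
Proof.
exists line_subbundle; split; first exact: line_bundle_line_subbundle.
pose fb b : {linear fibre E b -> fibre W b} := HB.pack
  (fun v : fibre E b => frame_coord v : fibre W b)
  (GRing.isLinear.Build _ _ _ _ _ (@frame_coord_linear b)).
exists to_whitney, of_whitney, fb; split.
- exact: to_whitney_continuous.
- exact: of_whitney_continuous.
- exact: to_whitneyK.
- exact: of_whitneyK.
- by move=> b v; rewrite to_whitney_fibre_point.
Qed.

End Frames.

(** * Differentials: locality and joint continuity *)

Lemma near_eq_diff (R : numFieldType) (V W : normedModType R) (f g : V -> W) x :
  (\forall y \near x, f y = g y) -> differentiable g x ->
  differentiable f x /\ 'd f x = 'd g x :> (V -> W).
Proof.
move=> fg dg; have dgc : continuous ('d g x) by exact: diff_continuous.
(* The first-order expansion of [g] at [x] only sees its germ, so it is also one of [f]; uniqueness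
   of the differential then concludes. *)
have fxE : f \o shift x = cst (f x) + 'd g x +o_ 0 id.
  apply/eqaddoP => eps eps0.
  have /eqaddoP/(_ _ eps0) := diff_locally dg; apply: filter_app.
  have : \forall y \near 0, f (y + x) = g (y + x).
    have /= := near_shift 0 x (fun y => f y = g y); rewrite subr0 => <-.
    exact: fg.
  apply: filter_app; near=> y => fgy; rewrite !fctE /= fgy.
  by rewrite (nbhs_singleton fg).
have dfE : 'd f x = 'd g x :> (V -> W) by exact: diff_unique.
by split; [apply/diff_locallyP; rewrite dfE|exact: dfE].
Unshelve. all: by end_near. Qed.

Lemma continuous_mulmx (R : realType) m n (Q : 'M[R]_(m, n)) :
  continuous (mulmx Q : 'cV[R]_n -> 'cV[R]_m).
Proof.
rewrite (_ : mulmx Q = fun u : 'cV[R]_n => \sum_j u j 0 *: col j Q); last first.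
  apply/funext => u; apply/colP => i; rewrite !mxE summxE.
  by apply: eq_bigr => j _; rewrite !mxE mulrC.
move=> u; apply: continuous_at_sum => j.
by apply: continuousZr_tmp; exact: coord_continuous.
Qed.

Lemma smooth_on_differentiable (R : realType) (V W : normedModType R)
    (U : set V) (f : V -> W) x : smooth_on U f -> U x -> differentiable f x.
Proof. by move=> /(_ 1%N)[+ _]; exact. Qed.

(** Expanding [w] in the standard basis gives a finite sum of coordinates of [w] times directional
    derivatives of [f], which are continuous since [f] is of class C^1. *)
Lemma continuous_diff_apply (R : realType) (n : nat) (W : normedModType R)
    (U : set 'cV[R]_n) (f : 'cV[R]_n -> W) (X : topologicalType)
    (y w : X -> 'cV[R]_n) x :
  open U -> smooth_on U f -> {for x, continuous y} -> {for x, continuous w} ->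
  U (y x) -> {for x, continuous (fun t => 'd f (y t) (w t))}.
Proof.
move=> oU sf cy cw Ux.
apply: (@near_eq_continuous_at _ _ _
  (fun t => \sum_j w t j 0 *: 'D_(delta_mx j 0) f (y t))).
  near=> t; have Ut : U (y t).
    by near: t; exact: (cy U (open_nbhs_nbhs (conj oU Ux))).
  rewrite [in LHS](matrix_sum_delta (w t)) linear_sum; apply: eq_bigr => j _.
  rewrite big_ord1 linearZ deriveE//; exact: (smooth_on_differentiable sf).
apply: continuous_at_sum => j; apply: continuousZ.
  apply: (@continuous_comp _ _ _ w (fun u : 'cV[R]_n => u j 0)) => //.
  exact: coord_continuous.
apply: (@continuous_comp _ _ _ y (fun z => 'D_(delta_mx j 0) f z)) => //.
by have [_ /(_ (delta_mx j 0))] := sf 1%N; apply.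
Unshelve. all: by end_near. Qed.

(** * The chain rule for transition maps *)

Section Charts.
Variables (R : realType) (n : nat) (M : topologicalType).
Implicit Types a b c d : chart R n M.

Lemma transition_domain_open c d : open (transition_domain c d).
Proof.
rewrite openE => x [tx sx]; apply: filterI.
  by apply: open_nbhs_nbhs; split=> //; exact: target_open.
apply: (phomeo_inv_continuous tx); apply: open_nbhs_nbhs; split=> //.
exact: source_open.
Qed.

Lemma transition_chart c d p :
  source c p -> transition c d (phomeo_fun c p) = phomeo_fun d p.
Proof. by move=> cp; rewrite /transition /= phomeo_funK. Qed.

Lemma transition_domain_chart c d p : source c p -> source d p ->
  transition_domain c d (phomeo_fun c p).
Proof.
by move=> cp dp; split; [exact: phomeo_fun_target|rewrite phomeo_funK].
Qed.

Lemma diff_transition_comp a b c p (v : 'cV[R]_n) :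
  compatible a b -> compatible b c -> source a p -> source b p -> source c p ->
  'd (transition b c) (phomeo_fun b p) ('d (transition a b) (phomeo_fun a p) v)
    = 'd (transition a c) (phomeo_fun a p) v.
Proof.
move=> [ab _] [bc _] ap bp cp.
have dab := smooth_on_differentiable ab (transition_domain_chart ap bp).
have := smooth_on_differentiable bc (transition_domain_chart bp cp).
rewrite -(transition_chart b ap) => dbc.
have acE : \forall y \near phomeo_fun a p,
    transition a c y = (transition b c \o transition a b) y.
  near=> y; have [_ yb] : transition_domain a b y.
    near: y; apply: open_nbhs_nbhs; split; first exact: transition_domain_open.
    exact: transition_domain_chart.
  by rewrite /transition /= phomeo_funK.
have dabc := differentiable_comp dab dbc.
have [_ /(congr1 (@^~ v)) acd] := near_eq_diff acE dabc.
apply: esym; apply: (etrans acd).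
exact: (congr1 (@^~ v) (diff_comp dab dbc)).
Unshelve. all: by end_near. Qed.

Lemma diff_transition_id c p (v : 'cV[R]_n) : source c p ->
  'd (transition c c) (phomeo_fun c p) v = v.
Proof.
move=> cp; have idE : \forall y \near phomeo_fun c p, transition c c y = id y.
  near=> y; rewrite /transition /= phomeo_invK//.
  near: y; apply: open_nbhs_nbhs; split; first exact: target_open.
  exact: phomeo_fun_target.
have [_ /(congr1 (@^~ v)) idd] := near_eq_diff idE ex_diff.
by apply: (etrans idd); rewrite diff_val.
Unshelve. all: by end_near. Qed.

End Charts.

(** * Trivializations of the tangent bundle from smooth charts *)

Section TangentTrivialization.
Variables (R : realType) (n : nat) (M : topologicalType).
Variable A : smooth_manifold R n M.
Local Notation I := (chart_index A).
Local Notation ch := (chart_at A).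
Local Notation TM := (tangent_point A).

Lemma tangent_subbase_open (O : set TM) : tangent_subbase O -> open O.
Proof.
move=> sO; exists [set O]; last by rewrite bigcup_set1.
move=> _ ->; exists [fset O]%fset; last first.
  apply/seteqP; split=> [x xO|x Ox V]; first by apply: xO; exact: fset11.
  by move=> /fset1P ->.
by move=> V /fset1P ->; rewrite inE.
Qed.

Lemma continuous_at_tangent (X : topologicalType) (f : X -> TM) x :
  (forall O, tangent_subbase O -> O (f x) -> \forall y \near x, O (f y)) ->
  {for x, continuous f}.
Proof.
move=> H V; rewrite [nbhs (f x)]nbhsE => -[_ [[D sD <-] [C DC Cfx]] CV].
suff : \forall y \near x, C (f y).
  move=> Cf; change (nbhs x (f @^-1` V)); apply: filterS Cf => y Cy.
  by apply: CV; exists C.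
have [F sF CE] := sD _ DC; rewrite -CE in Cfx *.
apply: filter_bigI => O FO; apply: H; last exact: Cfx.
by have := sF _ FO; rewrite inE.
Qed.

Lemma tangent_chart_continuous i (x : TM) : source (ch i) (projT1 x) ->
  {for x, continuous (@tangent_chart _ _ _ A i)}.
Proof.
move=> ix V; rewrite nbhsE => -[W [oW Wx] WV].
change (nbhs x (@tangent_chart _ _ _ A i @^-1` V)).
rewrite nbhsE.
exists [set e | source (ch i) (projT1 e) /\ W (tangent_chart i e)].
  by split=> //; apply: tangent_subbase_open; exists i, W.
by move=> e [_ /WV].
Qed.

Lemma source_tangent_open i : open [set x : TM | source (ch i) (projT1 x)].
Proof.
apply: tangent_subbase_open; exists i, setT; split; first exact: openT.
by apply/seteqP; split=> [x|x []].
Qed.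

(** Locally the base point is recovered from the first component of a tangent chart by inverting the
    chart of the manifold. *)
Lemma tangent_proj_continuous : continuous (@projT1 _ _ : TM -> M).
Proof.
move=> x; have [i ix] := chart_cover A (projT1 x).
apply: (@near_eq_continuous_at _ _ _
  (fun y => phomeo_inv (ch i) (tangent_chart i y).1)).
  near=> y; rewrite /= phomeo_funK//; near: y.
  by apply: open_nbhs_nbhs; split=> //; exact: source_tangent_open.
apply: (@continuous_comp _ _ _ (fun y => (tangent_chart i y).1)).
  apply: (@continuous_comp _ _ _ (@tangent_chart _ _ _ A i) fst).
    exact: tangent_chart_continuous.
  exact: cvg_fst.
by apply: phomeo_inv_continuous; exact: phomeo_fun_target.
Unshelve. all: by end_near. Qed.

Definition index_at p : I := projT1 (cid (chart_cover A p)).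

Lemma index_atP p : source (ch (index_at p)) p.
Proof. by rewrite /index_at; case: cid. Qed.

(** The coordinates of a tangent vector in any chart of the maximal atlas. Tangent vectors only
    record coordinates in charts of the given atlas, hence the detour through a chosen one;
    [chart_vecE] shows that the choice is immaterial. *)
Definition chart_vec (c : chart R n M) (x : TM) : 'cV[R]_n :=
  let i := index_at (projT1 x) in
  'd (transition (ch i) c) (phomeo_fun (ch i) (projT1 x)) (projT2 x i).

Lemma tangent_coord_diff p (v : tangent_space A p) i j :
  source (ch i) p -> source (ch j) p ->
  v j = 'd (transition (ch i) (ch j)) (phomeo_fun (ch i) p) (v i).
Proof. by have /asboolP[_ H] := tangent_coordP v; exact: H. Qed.

Lemma tangent_coord_out p (v : tangent_space A p) i :
  ~ source (ch i) p -> v i = 0.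
Proof. by have /asboolP[H _] := tangent_coordP v; exact: H. Qed.

Lemma tangent_coord_linear p i :
  linear (fun v : tangent_space A p => v i).
Proof.
by move=> t u v; rewrite -[tangent_coord _]/(val (t *: u + v)) linearP.
Qed.

Section SmoothChart.
Variable c : chart R n M.
Hypothesis sc : smooth_chart A c.

Let scC i : compatible c (ch i).
Proof. by have [] := sc i. Qed.

Lemma chart_vecE p (v : tangent_space A p) i : source c p -> source (ch i) p ->
  chart_vec c (existT _ p v) =
  'd (transition (ch i) c) (phomeo_fun (ch i) p) (v i).
Proof.
move=> cp ip; rewrite /chart_vec /=.
have jp := index_atP p; rewrite (tangent_coord_diff v ip jp).
exact: (diff_transition_comp _ (chart_compatible _ _) (sc _)).
Qed.

(** The inverse of [chart_vec c]. The value 0 at charts missing [p] is the convention of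
    [tangent_pred]; the value 0 when [c] misses [p] makes this a tangent vector at every [p]. *)
Definition chart_tangent_coord p (w : 'cV[R]_n) : I -> 'cV[R]_n := fun i =>
  if `[< source c p /\ source (ch i) p >] then
    'd (transition c (ch i)) (phomeo_fun c p) w else 0.

Fact chart_tangent_coordP p w :
  chart_tangent_coord p w \in tangent_pred (A := A) p.
Proof.
apply/asboolP; split=> [i ip|i j ip jp]; rewrite /chart_tangent_coord.
  by case: asboolP => // -[].
have [cp|cp] := pselect (source c p); last first.
  by case: asboolP => [[]//|_]; case: asboolP => [[]//|_]; rewrite linear0.
rewrite !asboolT//; apply: esym.
exact: (diff_transition_comp _ (scC _) (chart_compatible _ _)).
Qed.

Definition chart_tangent p w : tangent_space A p :=
  TangentVector (chart_tangent_coordP p w).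

Lemma chart_tangentE p w i : source c p -> source (ch i) p ->
  chart_tangent p w i = 'd (transition c (ch i)) (phomeo_fun c p) w.
Proof. by move=> cp ip; rewrite /= /chart_tangent_coord asboolT. Qed.

Lemma chart_tangentK p w : source c p ->
  chart_vec c (existT _ p (chart_tangent p w)) = w.
Proof.
move=> cp; have ip := index_atP p.
rewrite (chart_vecE _ cp ip) chart_tangentE//.
rewrite (diff_transition_comp _ (scC _) (sc _))//.
exact: diff_transition_id.
Qed.

Lemma chart_vecK p (v : tangent_space A p) : source c p ->
  chart_tangent p (chart_vec c (existT _ p v)) = v.
Proof.
move=> cp; apply: val_inj; apply/funext => i /=.
have [ip|ip] := pselect (source (ch i) p); last first.
  rewrite (tangent_coord_out v ip) /chart_tangent_coord.
  by case: asboolP => // -[].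
rewrite -[LHS]/(chart_tangent p _ i) chart_tangentE// (chart_vecE _ cp ip).
rewrite (diff_transition_comp _ (sc _) (scC _))//.
by rewrite diff_transition_id.
Qed.

Lemma chart_vec_linear p :
  linear (fun v : tangent_space A p => chart_vec c (existT _ p v)).
Proof.
move=> t u v; rewrite /chart_vec -linearP; apply: congr1.
exact: tangent_coord_linear.
Qed.

Lemma chart_vec_continuous (x : TM) : source c (projT1 x) ->
  {for x, continuous (chart_vec c)}.
Proof.
move=> cx; have ix := index_atP (projT1 x).
(* The index is frozen at its value at [x]: [chart_vec] picks one afresh at each point, with no
   continuity, and [chart_vecE] allows comparison with a fixed one nearby. *)
move: (index_at _) ix => i ix.
have vE (e : TM) : source c (projT1 e) -> source (ch i) (projT1 e) ->
    chart_vec c e =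
    'd (transition (ch i) c) ((tangent_chart i e).1) (tangent_chart i e).2.
  by case: e => p v; exact: chart_vecE.
have smooth_ic : smooth_on _ _ := (sc i).1.
apply: (@near_eq_continuous_at _ _ _ (fun y : TM =>
  'd (transition (ch i) c) ((tangent_chart i y).1) (tangent_chart i y).2)).
  near=> y; have iy : source (ch i) (projT1 y).
    near: y; apply: open_nbhs_nbhs; split=> //; exact: source_tangent_open.
  have cy : source c (projT1 y).
    near: y; apply: tangent_proj_continuous.
    by apply: open_nbhs_nbhs; split=> //; exact: source_open.
  exact: vE.
have ct := tangent_chart_continuous ix.
apply: (continuous_diff_apply (@transition_domain_open _ _ _ (ch i) c)
  smooth_ic).
- apply: (@continuous_comp _ _ _ (@tangent_chart _ _ _ A i) fst).
    exact: ct.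
  exact: cvg_fst.
- apply: (@continuous_comp _ _ _ (@tangent_chart _ _ _ A i) snd).
    exact: ct.
  exact: cvg_snd.
- exact: transition_domain_chart.
Unshelve. all: by end_near. Qed.

Lemma chart_tangent_continuous (y : M * 'cV[R]_n) : source c y.1 ->
  {for y, continuous
     (fun z : M * 'cV[R]_n => existT _ z.1 (chart_tangent z.1 z.2) : TM)}.
Proof.
move=> cy; apply: continuous_at_tangent => _ [i [W [oW ->]]] [/= iy Wy].
have fst_near (U : set M) : open U -> U y.1 -> \forall z \near y, U z.1.
  move=> oU Uy; apply: (cvg_fst (F := nbhs y.1) (G := nbhs y.2)).
  exact: open_nbhs_nbhs.
have nc := fst_near _ (source_open c) cy.
have ni := fst_near _ (source_open (ch i)) iy.
(* The map as read in the i-th tangent chart, so that membership in the subbasic set becomes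
   [W (g z)] near [y]. *)
pose g (z : M * 'cV[R]_n) := (phomeo_fun (ch i) z.1,
  'd (transition c (ch i)) (phomeo_fun c z.1) z.2).
have cg : {for y, continuous g}.
  have cf (d : chart R n M) : source d y.1 ->
      {for y, continuous (fun z : M * 'cV[R]_n => phomeo_fun d z.1)}.
    move=> dy; apply: (@continuous_comp _ _ _ fst (phomeo_fun d)).
      exact: cvg_fst.
    exact: phomeo_fun_continuous.
  apply: continuous_at_pair; first exact: cf.
  apply: (continuous_diff_apply (@transition_domain_open _ _ _ c (ch i))
    (scC i).1).
  - exact: cf.
  - exact: cvg_snd.
  - exact: transition_domain_chart.
have gE z : source c z.1 -> source (ch i) z.1 ->
    g z = tangent_chart i (existT _ z.1 (chart_tangent z.1 z.2)).
  by move=> cz iz; rewrite /g /tangent_chart chart_tangentE.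
have nW : \forall z \near y, W (g z).
  by apply: cg; apply: open_nbhs_nbhs; split=> //; rewrite gE.
by near=> z; split; [near: z|rewrite -gE; near: z].
Unshelve. all: by end_near. Qed.

(** The constant change of basis [Q] is there to send a given basis of R^n to the standard one, as
    [adapted] requires. *)
Lemma tangent_trivialization (Q : 'M[R]_n) : Q \in unitmx ->
  exists h : phomeo (total_space (tangent_bundle A)) (M * 'cV[R]_n)%type,
    trivialization (source c) h /\
    forall x, phomeo_fun h x = (projT1 x, Q *m chart_vec c x).
Proof.
move=> Qu.
pose S : set TM := [set x | source c (projT1 x)].
pose T : set (M * 'cV[R]_n) := source c `*` setT.
pose f (x : TM) := (projT1 x, Q *m chart_vec c x).
pose g (y : M * 'cV[R]_n) : TM :=
  existT _ y.1 (chart_tangent y.1 (invmx Q *m y.2)).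
have oS : open S.
  apply: open_comp (@source_open _ _ c) => x _.
  exact: tangent_proj_continuous.
have oT : open T.
  have -> : T = fst @^-1` source c.
    by apply/seteqP; split=> [[b u] []//|[b u] /= Ub]; split.
  by apply: open_comp (@source_open _ _ c) => x _; exact: cvg_fst.
have fT x : S x -> T (f x) by move=> Sx; split.
have gS y : T y -> S (g y) by case.
have fK x : S x -> g (f x) = x.
  by case: x => p v Sx; rewrite /g /f /= mulKmx// chart_vecK.
have gK y : T y -> f (g y) = y.
  by case: y => p u [cp _]; rewrite /g /f /= chart_tangentK// mulKVmx.
have fc x : S x -> {for x, continuous f}.
  move=> Sx; apply: continuous_at_pair; first exact: tangent_proj_continuous.
  apply: (@continuous_comp _ _ _ (chart_vec c) (mulmx Q)).
    exact: chart_vec_continuous.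
  exact: continuous_mulmx.
have gc y : T y -> {for y, continuous g}.
  move=> [cy _]; apply: (@continuous_comp _ _ _
    (fun z : M * 'cV[R]_n => (z.1, invmx Q *m z.2))
    (fun z : M * 'cV[R]_n => existT _ z.1 (chart_tangent z.1 z.2) : TM)).
    apply: continuous_at_pair; first exact: cvg_fst.
    apply: (@continuous_comp _ _ _ snd (mulmx (invmx Q))); first exact: cvg_snd.
    exact: continuous_mulmx.
  exact: chart_tangent_continuous.
exists (PHomeo oS oT fT gS fK gK fc gc); split=> //; split=> // p cp t u v.
by rewrite /= chart_vec_linear// mulmxDr scalemxAr.
Qed.

End SmoothChart.

Lemma chart_vec_chart_tangent c d (sc : smooth_chart A c)
    (sd : smooth_chart A d) p w : source c p -> source d p ->
  chart_vec c (existT _ p (chart_tangent sd p w)) =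
    'd (transition d c) (phomeo_fun d p) w.
Proof.
move=> cp dp; have ip := index_atP p.
rewrite (chart_vecE sc _ cp ip) chart_tangentE//.
by apply: (diff_transition_comp _ _ (sc _)) => //; have [] := sd (index_at p).
Qed.

End TangentTrivialization.

(** * A common eigenbasis for the holonomy group *)

Lemma involution_diagonalizable (F : fieldType) n (A : 'M[F]_n) :
  2%:R != 0 :> F -> A *m A = 1%:M -> diagonalizable A.
Proof.
(* Evaluating polynomials at [A] takes place in a nonzero matrix ring, so dimension zero is treated
   apart. *)
case: n A => [|n] A two_neq0 A2.
  by exists 1%:M; rewrite ?unitmx1//; apply/is_diag_mxP => -[].
apply/diagonalizableP; exists [:: 1; -1].
  by rewrite /= inE andbT -subr_eq0 opprK -mulr2n.
(* [A] is a root of (X - 1)(X + 1), whose roots are distinct because 2 is nonzero. *)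
rewrite big_cons big_seq1; apply: mxminpoly_min.
rewrite rmorphM /= !rmorphB /= horner_mx_X !horner_mx_C.
rewrite raddfN /= opprK mulrDr mulrBl mulrBl -mulmxE A2.
by rewrite !mulmx1 mul1mx addrA subrK subrr.
Qed.

Lemma commuting_involutions_eigenbasis (F : fieldType) n (As : seq 'M[F]_n) :
  2%:R != 0 :> F -> {in As &, forall A B, A *m B = B *m A} ->
  {in As, forall A, A *m A = 1%:M} ->
  exists2 P : 'M[F]_n, P \in unitmx & {in As, forall A,
    exists d : 'I_n -> F, forall k, d k != 0 /\
      A *m (P *m delta_mx k 0) = d k *: (P *m delta_mx k (0 : 'I_1))}.
Proof.
move=> two_neq0 Acomm A2.
have [|P Pu /allP Pdiag] := (codiagonalizableP As).1.
  by split=> // A /A2; exact: involution_diagonalizable.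
(* Codiagonalization makes P A P^-1 diagonal, so the common eigenvectors are the columns of the
   inverse. *)
exists (invmx P); rewrite ?unitmx_inv// => A AAs.
have /diagonalizable_forPex[D /(simmxLR Pu)] := Pdiag A AAs.
rewrite mxpoly.conjVmx// => DE; exists (fun k => D 0 k) => k.
have AE : A *m (invmx P *m delta_mx k (0 : 'I_1)) =
    D 0 k *: (invmx P *m delta_mx k (0 : 'I_1)).
  rewrite DE -!mulmxA mulKVmx//.
  rewrite scalemxAr; congr (_ *m _); apply/colP => i.
  by rewrite mul_diag_mx !mxE; case: eqVneq => [->//|]; rewrite /= !mulr0.
(* A zero eigenvalue would make the square of [A], which is the identity, kill a column of an
   invertible matrix. *)
split=> //; apply/eqP => D0.
have : A *m (A *m (invmx P *m delta_mx k (0 : 'I_1))) = 0.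
  by rewrite AE D0 scale0r mulmx0.
rewrite mulmxA A2// mul1mx => /(congr1 (mulmx P)); rewrite mulKVmx// mulmx0.
by move=> /colP/(_ k)/eqP; rewrite !mxE !eqxx oner_eq0.
Qed.

(** The source of [f] is abelian of exponent two, so its values commute and square to [f 0]. That
    matrix is idempotent and, by the invertibility assumption, equals the identity. *)
Lemma elementary_2group_eigenbasis (R : realType) n m (H : set 'M[R]_n) :
  elementary_2group m H -> (forall A, H A -> A \in unitmx) ->
  exists2 P : 'M[R]_n, P \in unitmx & forall A, H A ->
    exists d : 'I_n -> R, forall k, d k != 0 /\
      A *m (P *m delta_mx k 0) = d k *: (P *m delta_mx k (0 : 'I_1)).
Proof.
move=> [f [_ fD fH]] Hunit.
have f0 : f 0 = 1%:M.
  have fu : f 0 \in unitmx by apply: Hunit; rewrite -fH; exists 0.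
  by rewrite -[LHS](mulKmx fu) -fD addr0 mulVmx.
have fC u v : f u *m f v = f v *m f u by rewrite -!fD addrC.
have f2 u : f u *m f u = 1%:M.
  rewrite -fD -f0; congr f; apply/rowP => i; rewrite !mxE.
  by apply: val_inj; case: (u _ _) => -[|[|]].
have [|||P Pu PE] := @commuting_involutions_eigenbasis R n (codom f).
- by rewrite pnatr_eq0.
- by move=> _ _ /codomP[u ->] /codomP[v ->].
- by move=> _ /codomP[u ->].
by exists P => // A; rewrite -fH => -[u _ <-]; apply: PE; exact: codom_f.
Qed.

(** * Deck transformations and the descended frame *)

Lemma diff_affine (R : realType) n (g : affine R n) x :
  differentiable (affine_act g) x /\
  'd (affine_act g) x = mulmx g.1 :> (_ -> _).
Proof.
have dl : is_diff x (mulmx g.1 : 'cV[R]_n -> 'cV[R]_n) (mulmx g.1).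
  have cg : continuous (mulmx g.1 : 'cV[R]_n -> 'cV[R]_n).
    exact: continuous_mulmx.
  by split; [exact: linear_differentiable|exact: diff_lin].
have dg : is_diff x (affine_act g) (mulmx g.1 + 0) by exact: is_diffD.
split; first exact: ex_diff.
by apply: (etrans (@diff_val _ _ _ _ _ _ _ dg)); rewrite addr0.
Qed.

(** Both charts invert [q], and [q] is invariant under [g]; near [y] the transition map is therefore
    the deck transformation [g] itself. *)
Lemma diff_transition_orbit (R : realType) n (M : topologicalType)
    (c d : chart R n M) (q : 'cV[R]_n -> M) (g : affine R n) y w :
  (forall z, target c z -> phomeo_inv c z = q z) ->
  (forall z, target d z -> phomeo_inv d z = q z) ->
  (forall z, q (affine_act g z) = q z) ->
  target d y -> target c (affine_act g y) ->
  'd (transition d c) y w = g.1 *m w.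
Proof.
move=> cq dq gq dy cgy; have [dg dgE] := diff_affine g y.
have E : \forall z \near y, transition d c z = affine_act g z.
  near=> z; have dz : target d z.
    by near: z; apply: open_nbhs_nbhs; split=> //; exact: target_open.
  have cgz : target c (affine_act g z).
    near: z; apply: (differentiable_continuous dg).
    by apply: open_nbhs_nbhs; split=> //; exact: target_open.
  by rewrite /transition /= dq// -gq -cq// phomeo_invK.
have [_ /(congr1 (@^~ w)) E'] := near_eq_diff E dg.
by apply: (etrans E'); rewrite dgE.
Unshelve. all: by end_near. Qed.

Theorem proposition1 (R : realType) (n : nat) (M : topologicalType)
    (A : smooth_manifold R n M) :
  hantzsche_wendt A -> line_element_parallelizable A.
Proof.
move=> [_ _ [G [[Gisom _ _ _] _ _ _ [q [q_onto q_orbit q_chart]]] holG]].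
have [P Pu Pdiag] : exists2 P : 'M[R]_n, P \in unitmx &
    forall g, G g -> exists d : 'I_n -> R, forall k, d k != 0 /\
      g.1 *m (P *m delta_mx k 0) = d k *: (P *m delta_mx k (0 : 'I_1)).
  have [|P Pu PE] := elementary_2group_eigenbasis holG.
    by move=> _ [g /Gisom gO <-]; have [] := mulmx1_unit gO.
  by exists P => // g Gg; apply: PE; exists g.
have Gq g x : G g -> q (affine_act g x) = q x.
  by move=> Gg; apply/esym/q_orbit; exists g.
(* An arbitrary lift [s] of the points of [M], with no continuity, and around each [x] of R^n a
   chart [c x] that inverts [q]. *)
have [s sK] := choice q_onto.
have [c cP] := choice q_chart.
have sc x : smooth_chart A (c x) by have [] := cP x.
have tc x : target (c x) x by have [] := cP x.
have cq x y : target (c x) y -> phomeo_inv (c x) y = q y.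
  by have [_ _ +] := cP x; exact.
have cs p : source (c (s p)) p.
  by rewrite -[X in source _ X]sK -(cq _ _ (tc _)); exact: phomeo_inv_source.
have csE p : phomeo_fun (c (s p)) p = s p.
  by rewrite -[X in phomeo_fun _ X]sK -(cq _ _ (tc _)) phomeo_invK.
(* The image under the differential of [q] at [s p] of the constant vector [P e_k]. *)
pose e (p : M) (k : 'I_n) : tangent_space A p :=
  chart_tangent (sc (s p)) p (P *m delta_mx k 0).
exists n; apply: (@line_splitting R M (tangent_bundle A) n e).
  exact: tangent_proj_continuous.
move=> p0; pose c0 := c (s p0).
have [h [hT hE]] := tangent_trivialization (sc (s p0)) (Q := invmx P)
  (etrans (unitmx_inv _) Pu).
have a_ex p : exists a : 'I_n -> R, source c0 p -> forall k, a k != 0 /\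
    (phomeo_fun h (fibre_point (tangent_bundle A) (e p k))).2 =
      a k *: delta_mx k 0.
  (* Outside the source of [c0] nothing is required of the factors, and 0 is a dummy value. *)
  have [c0p|] := pselect (source c0 p); last by exists (fun=> 0).
  (* The lift [s p] and the lift of [p] given by [c0] differ by some [g] in [G]; the factors sought
     are the eigenvalues of [g.1] on the vectors [P e_k]. *)
  have : q (s p) = q (phomeo_fun c0 p).
    by rewrite sK -(cq (s p0)) ?phomeo_funK//; exact: phomeo_fun_target.
  move=> /q_orbit[g Gg gE]; have [d dP] := Pdiag g Gg; exists d => _ k.
  have [dk0 dkE] := dP k; split=> //; rewrite hE /=.
  rewrite chart_vec_chart_tangent// csE
    (@diff_transition_orbit _ _ _ _ _ q g)//.
  - by rewrite dkE -scalemxAr mulKmx.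
  - exact: cq.
  - exact: cq.
  - by move=> z; exact: Gq.
  - by rewrite gE; exact: phomeo_fun_target.
have [a aP] := choice a_ex.
exists (source c0), h, a; split; last exact: cs.
by split=> // [|p k c0p]; [exact: source_open|exact: aP].
Qed.
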